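(* Let $l,m,n,k$ be positive integers and let $$X=\underbrace{\mathbf{P}^1\times\cdots\times\mathbf{P}^1}_{l}\times\underbrace{\mathbf{P}^3\times\cdots\times\mathbf{P}^3}_{m}\times\underbrace{\mathbf{P}^5\times\cdots\times\mathbf{P}^5}_{n}$$ be the Cartesian product of $l$ copies of $\mathbf{P}^1$, $m$ copies of $\mathbf{P}^3$ and $n$ copies of $\mathbf{P}^5$ over $\mathbb{C}$. Put $\mu=2^{l+2m+n-1}3^n-1$. Then there exists a monad on $X$ of the form $$0\longrightarrow \mathcal{O}_X(-1,\ldots,-1)^{\oplus k}\xrightarrow{\ \overline{A}\ }\mathcal{O}_X^{\oplus (2\mu+2k)}\xrightarrow{\ \overline{B}\ }\mathcal{O}_X(1,\ldots,1)^{\oplus k}\longrightarrow 0 .$$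
   Context: For integers $d_1,\ldots,d_{l+m+n}$, $\mathcal{O}_X(d_1,\ldots,d_{l+m+n})$ denotes the tensor product of the pullbacks to $X$, under the projections onto the $l+m+n$ factors, of the line bundles $\mathcal{O}(d_1),\ldots,\mathcal{O}(d_{l+m+n})$ on the respective factors. A monad on a nonsingular projective variety $X$ is a complex of vector bundles $0\to M_0\xrightarrow{\alpha}M_1\xrightarrow{\beta}M_2\to 0$ (so $\beta\circ\alpha=0$) which is exact at $M_0$ and at $M_2$, i.e. $\alpha$ is injective and $\beta$ is surjective. Its cohomology bundle is the vector bundle $E=\ker(\beta)/\operatorname{im}(\alpha)$. *)

(* Defs.v *)
(* Varieties are classical ones: the points are the closed points, with the
   Zariski topology and the regular functions.  Vector bundles are given by
   their transition functions. *)
From HB Require Import structures.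
From mathcomp Require Import all_boot all_order all_algebra.
From mathcomp Require Import mpoly complex classical_sets reals.

Set Implicit Arguments.
Unset Strict Implicit.
Unset Printing Implicit Defensive.

Import GRing.Theory.
Local Open Scope classical_set_scope.
Local Open Scope ring_scope.

Definition proj (K : closedFieldType) (n : nat) : Type :=
  {L : {vspace 'rV[K]_n.+1} | \dim L == 1%N}.

(* One choice of homogeneous coordinates, hence only meaningful up to a nonzero
   factor.  Below it occurs only in expressions that do not depend on it:
   vanishing of multihomogeneous polynomials and ratios of equal multidegree. *)
Definition hcoord (K : closedFieldType) (n : nat) (x : proj K n) : 'rV[K]_n.+1 :=
  vpick (val x).

Definition mproj (K : closedFieldType) (I : finType) (e : I -> nat) : Type :=
  forall i, proj K (e i).

Section Multiprojective.
Variables (K : closedFieldType) (I : finType) (e : I -> nat).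
Local Notation X := (mproj K e).

(* The homogeneous coordinate j on the factor i is the variable of index
   enum_rank (i, j). *)
Definition hvar : finType := {i : I & 'I_(e i).+1}.

Definition mkvar (i : I) (j : 'I_(e i).+1) : 'I_#|{: hvar}| :=
  enum_rank (Tagged (fun i => 'I_(e i).+1) j : hvar).

Definition multihomogeneous (a : I -> nat) (p : {mpoly K[#|{: hvar}|]}) : Prop :=
  forall mon, mon \in msupp p ->
  forall i, (\sum_(j < (e i).+1) mon (mkvar j))%N = a i.

Definition peval (p : {mpoly K[#|{: hvar}|]}) (x : X) : K :=
  p.@[fun v => hcoord (x (tag (enum_val v))) 0 (tagged (enum_val v))].

Definition zariski_open (U : set X) : Prop :=
  exists S : set {mpoly K[#|{: hvar}|]},
    (forall p, S p -> exists a, multihomogeneous a p) /\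
    (forall x, U x <-> exists2 p, S p & peval p x != 0).

Definition regular (U : set X) (f : X -> K) : Prop :=
  forall x, U x -> exists W : set X,
    [/\ zariski_open W, W x, W `<=` U &
      exists a p q, [/\ multihomogeneous a p, multihomogeneous a q &
        forall y, W y -> peval q y != 0 /\ f y = peval p y / peval q y]].

Definition regular_mx (p q : nat) (U : set X) (f : X -> 'M[K]_(p, q)) : Prop :=
  forall i j, regular U (fun x => f x i j).

End Multiprojective.

(* Fibre coordinates are column vectors, and tr a b x sends the coordinates of a
   vector of the fibre at x in the chart a to its coordinates in the chart b. *)
Record cocycle (K : closedFieldType) (T : Type) (r : nat) := Cocycle {
  chart : Type;
  dom : chart -> set T;
  tr : chart -> chart -> T -> 'M[K]_r }.

Definition is_bundle (K : closedFieldType) (I : finType) (e : I -> nat) (r : nat)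
    (E : cocycle K (mproj K e) r) : Prop :=
  [/\ forall a : chart E, zariski_open (dom a),
      forall x, exists a : chart E, dom a x,
      forall a b : chart E, regular_mx (dom a `&` dom b) (tr a b),
      forall (a : chart E) x, dom a x -> tr a a x = 1%:M &
      forall (a b c : chart E) x, dom a x -> dom b x -> dom c x ->
        tr b c x *m tr a b x = tr a c x].

(* On the chart x_i != 0, a local section s of O(d), seen as a function of the
   homogeneous coordinates that is homogeneous of degree d, has the coordinate
   s / x_i ^ d. *)
Definition projO (K : closedFieldType) (n : nat) (d : int) :
    cocycle K (proj K n) 1 :=
  @Cocycle K (proj K n) 1 'I_n.+1
    (fun i => [set x | hcoord x 0 i != 0])
    (fun i j x => ((hcoord x 0 i / hcoord x 0 j) ^ d)%:M).

Definition pullback (K : closedFieldType) (S T : Type) (r : nat) (f : S -> T)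
    (E : cocycle K T r) : cocycle K S r :=
  @Cocycle K S r (chart E) (fun a => f @^-1` dom a) (fun a b x => tr a b (f x)).

Definition line_tensor (K : closedFieldType) (I : finType) (T : Type)
    (L : I -> cocycle K T 1) : cocycle K T 1 :=
  @Cocycle K T 1 (forall i, chart (L i))
    (fun a => [set x | forall i, dom (a i) x])
    (fun a b x => (\prod_i tr (a i) (b i) x 0 0)%:M).

Definition trivial_line (K : closedFieldType) (T : Type) : cocycle K T 1 :=
  @Cocycle K T 1 unit (fun=> setT) (fun _ _ _ => 1%:M).

Definition line_sum (K : closedFieldType) (T : Type) (k : nat)
    (L : cocycle K T 1) : cocycle K T k :=
  @Cocycle K T k (chart L) (fun a => dom a) (fun a b x => (tr a b x 0 0)%:M).

Definition mprojO (K : closedFieldType) (I : finType) (e : I -> nat)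
    (d : I -> int) : cocycle K (mproj K e) 1 :=
  line_tensor (fun i => pullback (fun x : mproj K e => x i) (projO K (e i) (d i))).

(* mor a b x is the matrix, in the charts a of E and b of F, of the linear map
   between the fibres at x. *)
Record bundle_hom (K : closedFieldType) (I : finType) (e : I -> nat) (r s : nat)
    (E : cocycle K (mproj K e) r) (F : cocycle K (mproj K e) s) := BundleHom {
  mor : chart E -> chart F -> mproj K e -> 'M[K]_(s, r);
  mor_regular : forall a b, regular_mx (dom a `&` dom b) (mor a b);
  mor_compat : forall a a' b b' x, dom a x -> dom a' x -> dom b x -> dom b' x ->
    mor a' b' x *m tr a a' x = tr b b' x *m mor a b x }.

Section Monad.
Variables (K : closedFieldType) (I : finType) (e : I -> nat).

Definition hom_injective (r s : nat) (E : cocycle K (mproj K e) r)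
    (F : cocycle K (mproj K e) s) (f : bundle_hom E F) : Prop :=
  forall a b x, dom a x -> dom b x ->
    injective (fun v : 'cV[K]_r => mor f a b x *m v).

Definition hom_surjective (r s : nat) (E : cocycle K (mproj K e) r)
    (F : cocycle K (mproj K e) s) (f : bundle_hom E F) : Prop :=
  forall a b x, dom a x -> dom b x ->
    forall w : 'cV[K]_s, exists v : 'cV[K]_r, mor f a b x *m v = w.

(* Injectivity and surjectivity are those of maps of vector bundles, i.e. they
   hold on every fibre, so that ker / im is again a vector bundle. *)
Definition is_monad (r0 r1 r2 : nat) (M0 : cocycle K (mproj K e) r0)
    (M1 : cocycle K (mproj K e) r1) (M2 : cocycle K (mproj K e) r2)
    (alpha : bundle_hom M0 M1) (beta : bundle_hom M1 M2) : Prop :=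
  [/\ is_bundle M0 /\ is_bundle M1 /\ is_bundle M2,
      forall a b c x, dom a x -> dom b x -> dom c x ->
        mor beta b c x *m mor alpha a b x = 0,
      hom_injective alpha & hom_surjective beta].

End Monad.

Definition factor_dim (l m n : nat) (i : 'I_l + 'I_m + 'I_n) : nat :=
  match i with
  | inl (inl _) => 1
  | inl (inr _) => 3
  | inr _ => 5
  end.

(* Main.v *)
(** There are [2 * (mu + 1)] monomials of multidegree [(1, ..., 1)] on [X].  At
    a point, split their values into the coefficients of two polynomials [p] and
    [q] in one variable, of degree at most [mu] and not both zero since the
    monomials have no common zero.  Multiplication by [p] on polynomials of
    degree less than [k] has a banded Toeplitz matrix [T p] with [mu + k] rows,
    which is injective when [p != 0].  Let [J T J] be [T] with its rows and its
    columns reversed.  Then [(T p)^T * J (T q) J] is symmetric in [p] and [q]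
    since [p * q = q * p], hence the block row [(T p)^T, (T q)^T] and the block
    column [J (T q) J, - J (T p) J] have product zero; the former is surjective
    and the latter injective because [p] or [q] is nonzero. *)

Require Import Defs.
From mathcomp Require Import all_boot all_order all_algebra.
From mathcomp Require Import mpoly complex boolp classical_sets reals.

Set Implicit Arguments.
Unset Strict Implicit.
Unset Printing Implicit Defensive.

Import GRing.Theory.
Local Open Scope classical_set_scope.
Local Open Scope ring_scope.

(** * Toeplitz matrices of polynomials: the monad in one fibre *)

Section Toeplitz.
Variables (K : fieldType) (mu k : nat).

(** The outer multiplicity of the monad is [k.+1] from here on, so that [inord] can index the
    columns. *)
Definition toeplitz (p : {poly K}) : 'M[K]_((mu + k).+1, k.+1) :=
  \matrix_(i, j) ('X^j * p)`_i.

Definition rev_toeplitz (p : {poly K}) : 'M[K]_((mu + k).+1, k.+1) :=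
  \matrix_(i, j) toeplitz p (rev_ord i) (rev_ord j).

(** The product with [v] lists the coefficients of [P * p], where [P] has the coefficients [v];
    polynomials over a field have no zero divisors. *)
Lemma toeplitz_inj (p : {poly K}) (v : 'cV[K]_k.+1) :
  p != 0 -> (size p <= mu.+1)%N -> toeplitz p *m v = 0 -> v = 0.
Proof.
move=> p0 sp pv0; pose P := \poly_(j < k.+1) v (inord j) 0.
have P_p : P * p = 0.
  apply/polyP => i; rewrite coef0; have [ltiN|leNi] := ltnP i (mu + k).+1.
    move/matrixP/(_ (Ordinal ltiN) 0): pv0; rewrite !mxE => pv0; rewrite -[RHS]pv0.
    rewrite /P poly_def mulr_suml coef_sum; apply: eq_bigr => j _.
    by rewrite mxE -scalerAl coefZ inord_val mulrC.
  (* No coefficient is lost below the last row: the size of [P * p] is at most [k.+1 + mu.+1 - 1],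
     the number of rows. *)
  apply: nth_default; apply: leq_trans (size_polyMleq _ _) _.
  apply: leq_trans leNi; rewrite -subn1 leq_subLR add1n.
  apply: leq_trans (leq_add (size_poly _ _) sp) _.
  by rewrite addSn addnS addnC.
have P0 : P = 0 by apply/eqP; move/eqP: P_p; rewrite mulf_eq0 (negPf p0) orbF.
apply/colP => j; rewrite mxE; move/polyP/(_ j): P0.
by rewrite coef_poly ltn_ord inord_val coef0.
Qed.

Lemma rev_toeplitz_inj (p : {poly K}) (v : 'cV[K]_k.+1) :
  p != 0 -> (size p <= mu.+1)%N -> rev_toeplitz p *m v = 0 -> v = 0.
Proof.
move=> p0 sp pv0; pose w : 'cV[K]_k.+1 := \col_j v (rev_ord j) 0.
suff w0 : w = 0.
  apply/colP => j; move/colP/(_ (rev_ord j)): w0.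
  by rewrite !mxE rev_ordK.
apply: (toeplitz_inj p0 sp); apply/colP => i.
move/colP/(_ (rev_ord i)): pv0; rewrite !mxE => pv0; rewrite -[RHS]pv0.
rewrite (reindex_inj rev_ord_inj); apply: eq_bigr => j _.
by rewrite !mxE !rev_ordK.
Qed.

(* Both sides have the entry (i, j) equal to the coefficient of X^(mu + k) in
   X^(i + k - j) p q. *)
Lemma toeplitz_comm (p q : {poly K}) :
  (toeplitz p)^T *m rev_toeplitz q = (toeplitz q)^T *m rev_toeplitz p.
Proof.
suff E (r s : {poly K}) i j : ((toeplitz r)^T *m rev_toeplitz s) i j =
    ('X^i * r * ('X^(k - j) * s))`_(mu + k).
  by apply/matrixP => i j; rewrite !E; congr (_`_ _);
    rewrite mulrACA [p * q]mulrC -mulrACA.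
rewrite coefM mxE; apply: eq_bigr => t _.
by rewrite !mxE /= !subSS.
Qed.

Lemma size_monad_mid : ((mu + k).+1 + (mu + k).+1 = 2 * mu + 2 * k.+1)%N.
Proof. by rewrite -mulnDr -addnS mul2n -addnn addnS. Qed.

Definition monad_out (p q : {poly K}) :
    'M[K]_(k.+1, (mu + k).+1 + (mu + k).+1) :=
  (col_mx (toeplitz p) (toeplitz q))^T.

Definition monad_in (p q : {poly K}) :
    'M[K]_((mu + k).+1 + (mu + k).+1, k.+1) :=
  col_mx (rev_toeplitz q) (- rev_toeplitz p).

Lemma monad_out_in (p q : {poly K}) : monad_out p q *m monad_in p q = 0.
Proof.
by rewrite /monad_out tr_col_mx mul_row_col mulmxN toeplitz_comm subrr.
Qed.

Variables (p q : {poly K}).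
Hypotheses (sp : (size p <= mu.+1)%N) (sq : (size q <= mu.+1)%N).
Hypothesis (pq0 : (p != 0) || (q != 0)).

Lemma monad_in_inj : injective (fun v : 'cV[K]_k.+1 => monad_in p q *m v).
Proof.
move=> u v /= /eqP; rewrite -subr_eq0 -mulmxBr => /eqP; rewrite mul_col_mx.
rewrite -[0]vsubmxK => /eq_col_mx[]; rewrite !linear0 mulNmx => q0 /eqP.
rewrite oppr_eq0 => /eqP p0; apply/eqP; rewrite -subr_eq0.
by apply/eqP; case/orP: pq0 => ?; [apply: rev_toeplitz_inj p0|apply: rev_toeplitz_inj q0].
Qed.

(** A row-free matrix has a right inverse, and row-freeness is, after transposing, injectivity of
    the two stacked Toeplitz blocks. *)
Lemma monad_out_surj (w : 'cV[K]_k.+1) : exists v, monad_out p q *m v = w.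
Proof.
suff /row_freeP[C BC] : row_free (monad_out p q).
  by exists (C *m w); rewrite mulmxA BC mul1mx.
apply: inj_row_free => v /(congr1 trmx).
rewrite trmx_mul trmxK trmx0 mul_col_mx -[0]vsubmxK => /eq_col_mx[].
rewrite !linear0 => p0 q0; apply: trmx_inj; rewrite trmx0.
by case/orP: pq0 => ?; [apply: toeplitz_inj p0|apply: toeplitz_inj q0].
Qed.

End Toeplitz.

(** * Multihomogeneous polynomials, open sets and regular functions *)

Section Multiprojective.
Variables (K : closedFieldType) (I : finType) (e : I -> nat).
Local Notation X := (mproj K e).
Local Notation S := {mpoly K[#|{: hvar e}|]}.
Local Notation mchart := (forall i, 'I_(e i).+1).
Implicit Types (p q : S) (x : X) (d : I -> nat) (a b : mchart).

Lemma hcoord_neq0 (n : nat) (x : proj K n) : exists j, hcoord x 0 j != 0.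
Proof.
apply/existsP; rewrite -negb_forall; apply/negP => /forallP h0.
have : hcoord x == 0 by apply/eqP/rowP => j; rewrite mxE; apply/eqP.
by rewrite vpick0; case: x {h0} => L /= /eqP dL; apply/negP; rewrite -dimv_eq0 dL.
Qed.

Lemma multihomogeneous0 d : multihomogeneous d (0 : S).
Proof. by move=> mon; rewrite msupp0. Qed.

Lemma multihomogeneous1 : multihomogeneous (fun=> 0%N) (1 : S).
Proof.
move=> mon; rewrite msupp1 inE => /eqP-> i.
by apply: big1 => j _; rewrite mnm0E.
Qed.

Lemma multihomogeneousN d p : multihomogeneous d p -> multihomogeneous d (- p).
Proof. by move=> hp mon; rewrite (perm_mem (msuppN _)); apply: hp. Qed.

Lemma multihomogeneousM d d' p q :
  multihomogeneous d p -> multihomogeneous d' q ->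
  multihomogeneous (fun i => d i + d' i)%N (p * q).
Proof.
move=> hp hq mon /msuppM_le/allpairsP[[m1 m2] /= [/hp h1 /hq h2 ->]] i.
by rewrite -h1 -h2 -big_split /=; apply: eq_bigr => j _; rewrite mnmDE.
Qed.

Lemma multihomogeneousX d p n :
  multihomogeneous d p -> multihomogeneous (fun i => d i * n)%N (p ^+ n).
Proof.
move=> hp; elim: n => [|n IHn].
  by rewrite expr0 => mon /multihomogeneous1 h i; rewrite h muln0.
rewrite exprS => mon /(multihomogeneousM hp IHn) h i.
by rewrite h mulnS.
Qed.

Lemma pevalM p q x : peval (p * q) x = peval p x * peval q x.
Proof. exact: mevalM. Qed.

Lemma pevalX p n x : peval (p ^+ n) x = peval p x ^+ n.
Proof.
by elim: n => [|n IHn]; rewrite ?expr0 ?exprS ?pevalM ?IHn // /peval meval1.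
Qed.

Lemma zariski_openT : zariski_open (setT : set X).
Proof.
exists [set 1]; split=> [_ ->|x].
  by exists (fun=> 0%N); apply: multihomogeneous1.
by split=> // _; exists 1; rewrite // /peval meval1 oner_eq0.
Qed.

Lemma zariski_openI (U V : set X) :
  zariski_open U -> zariski_open V -> zariski_open (U `&` V).
Proof.
move=> [P [hP UP]] [Q [hQ VQ]].
exists [set r | exists2 p, P p & exists2 q, Q q & r = p * q]; split.
  move=> _ [p /hP[d hp] [q /hQ[d' hq] ->]].
  by exists (fun i => d i + d' i)%N; apply: multihomogeneousM.
move=> x; split=> [[/UP[p Pp p0] /VQ[q Qq q0]]|].
  by exists (p * q); [exists p => //; exists q|rewrite pevalM mulf_neq0].
move=> [_ [p Pp [q Qq ->]]]; rewrite pevalM mulf_eq0 negb_or => /andP[p0 q0].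
by split; [apply/UP; exists p|apply/VQ; exists q].
Qed.

Lemma regular_ratio (U : set X) (f : X -> K) d p q :
  zariski_open U -> multihomogeneous d p -> multihomogeneous d q ->
  (forall x, U x -> peval q x != 0 /\ f x = peval p x / peval q x) ->
  regular U f.
Proof. by move=> oU hp hq hf x Ux; exists U; split=> //; exists d, p, q. Qed.

Lemma regular_cst (U : set X) (c : K) :
  zariski_open U -> regular U (fun=> c).
Proof.
move=> oU; apply: (regular_ratio (p := c%:MP) oU _ multihomogeneous1).
  move=> mon; rewrite msuppC; case: ifP => //; rewrite inE => _ /eqP-> i.
  by apply: big1 => j _; rewrite mnm0E.
by move=> x _; rewrite /peval meval1 mevalC divr1 oner_eq0.
Qed.

(** * Standard charts and their monomials of multidegree (1, ..., 1) *)

Definition chart_mono a : S := \prod_i 'X_(mkvar (a i)).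

Definition chart_dom a : set X := [set x | forall i, hcoord (x i) 0 (a i) != 0].

Definition chart_val a x : K := \prod_i hcoord (x i) 0 (a i).

Lemma mkvar_eq i j (s : 'I_(e i).+1) (t : 'I_(e j).+1) :
  (mkvar s == mkvar t) = (Tagged (fun i => 'I_(e i).+1) s == Tagged _ t).
Proof. exact: (inj_eq enum_rank_inj). Qed.

Lemma multihomogeneous_chart a : multihomogeneous (fun=> 1%N) (chart_mono a).
Proof.
move=> mon; rewrite /chart_mono mprodXE msuppX inE => /eqP-> i.
rewrite (bigD1 (a i)) //= mnm_sumE (bigD1 i) //= mnm1E eqxx.
rewrite big1 => [|j ji]; first rewrite addn0 add1n big1 // => j ja.
  rewrite mnm_sumE big1 // => i' _; rewrite mnm1E mkvar_eq.
  apply/eqP; rewrite eqb0; apply: contra ja => /eqP E.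
  have ii : i' = i by apply: (congr1 tag E).
  by subst i'; move/eqP: E; rewrite eq_Tagged eq_sym.
rewrite mnm1E mkvar_eq; apply/eqP; rewrite eqb0; apply: contra ji => /eqP E.
by apply/eqP; apply: (congr1 tag E).
Qed.

Lemma peval_chart a x : peval (chart_mono a) x = chart_val a x.
Proof.
rewrite /peval /chart_mono rmorph_prod; apply: eq_bigr => i _.
by rewrite /= mevalXU enum_rankK.
Qed.

Lemma chart_valP a x : reflect (chart_dom a x) (chart_val a x != 0).
Proof.
apply: (iffP idP) => [/prodf_neq0 h i|h]; first exact: h.
by apply/prodf_neq0 => i _; apply: h.
Qed.

Lemma zariski_open_chart a : zariski_open (chart_dom a).
Proof.
exists [set chart_mono a]; split=> [_ ->|x].
  by exists (fun=> 1%N); apply: multihomogeneous_chart.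
split=> [/chart_valP a0|[_ ->]]; last by rewrite peval_chart => /chart_valP.
by exists (chart_mono a); rewrite ?peval_chart.
Qed.


(* The functions of the chosen homogeneous coordinates given by a form of
   multidegree (1, ..., 1); they are not functions on [X]. *)
Definition multilinear_form (f : X -> K) :=
  exists2 p : S, multihomogeneous (fun=> 1%N) p & peval p =1 f.

Lemma multilinear_form0 : multilinear_form (fun=> 0).
Proof. by exists 0; [apply: multihomogeneous0|move=> x; apply: meval0]. Qed.

Lemma multilinear_formN f : multilinear_form f -> multilinear_form (fun x => - f x).
Proof.
move=> [p hp pf]; exists (- p); first exact: multihomogeneousN.
by move=> x; rewrite -pf; apply: mevalN.
Qed.

Lemma multilinear_form_chart a : multilinear_form (chart_val a).
Proof.
by exists (chart_mono a); [apply: multihomogeneous_chart|apply: peval_chart].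
Qed.

(** Dividing by a monomial of the same multidegree, nonzero on the chart, removes the dependence on
    the chosen coordinates. *)
Lemma regular_multilinear_form (U : set X) a f :
  zariski_open U -> U `<=` chart_dom a -> multilinear_form f ->
  regular U (fun x => (chart_val a x)^-1 * f x).
Proof.
move=> oU Ua [p hp pf].
apply: (regular_ratio oU hp (@multihomogeneous_chart a)) => x /Ua/chart_valP a0.
by rewrite peval_chart a0 pf mulrC.
Qed.

Lemma regular_chart_ratio a b (c : int) :
  regular (chart_dom a `&` chart_dom b)
    (fun x => (chart_val a x / chart_val b x) ^ c).
Proof.
have oU := zariski_openI (zariski_open_chart a) (zariski_open_chart b).
have hX (b0 : mchart) n : multihomogeneous (fun=> 1 * n)%N (chart_mono b0 ^+ n).
  exact: multihomogeneousX (@multihomogeneous_chart b0).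
case: c => n.
  apply: (regular_ratio oU (hX a n) (hX b n)) => x [_ /chart_valP b0].
  by rewrite !pevalX !peval_chart expf_neq0 // -exprnP expr_div_n.
(* A negative exponent [- n.+1] exchanges numerator and denominator, so nonvanishing now comes from
   the chart [a]. *)
apply: (regular_ratio oU (hX b n.+1) (hX a n.+1)) => x [/chart_valP a0 _].
by rewrite !pevalX !peval_chart expf_neq0 // NegzE -exprnN expr_div_n invf_div.
Qed.

(** * The bundles O(c, ..., c) and the trivial bundles *)

Lemma tr_mprojO (r : nat) (c : int) a b x :
  tr (c := line_sum r (mprojO K e (fun=> c))) a b x =
    ((chart_val a x / chart_val b x) ^ c)%:M.
Proof.
rewrite /= !mxE eqxx mulr1n /chart_val -prodf_div.
rewrite (big_morph (fun y => y ^ c) (fun y z => expfzMl y z c) (exp1rz _ c)).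
by congr (_ %:M); apply: eq_bigr => i _; rewrite mxE eqxx mulr1n.
Qed.

Lemma mprojO_is_bundle (r : nat) (c : int) :
  is_bundle (line_sum r (mprojO K e (fun=> c))).
Proof.
split.
- exact: zariski_open_chart.
- by move=> x; exists (fun i => xchoose (hcoord_neq0 (x i))) => i;
    apply: (xchooseP (hcoord_neq0 (x i))).
(* The transition matrix is scalar: its entries are the chart ratio on the diagonal and the constant
   0 elsewhere. *)
- move=> a b i j; rewrite (_ : (fun x => _) = (fun x =>
    (chart_val a x / chart_val b x) ^ c *+ (i == j))); last first.
    by apply/funext => x; rewrite tr_mprojO mxE.
  case: eqP => _; first exact: regular_chart_ratio.
  apply: regular_cst.
  exact: zariski_openI (zariski_open_chart a) (zariski_open_chart b).
- by move=> a x /chart_valP a0; rewrite tr_mprojO divff // exp1rz.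
- move=> a b b' x _ /chart_valP b0 _; rewrite !tr_mprojO -scalar_mxM -expfzMl.
  by rewrite mulrC mulrA divfK.
Qed.

Lemma trivial_is_bundle (r : nat) :
  is_bundle (line_sum r (trivial_line K X)).
Proof.
split.
- by move=> a; apply: zariski_openT.
- by move=> x; exists tt.
- move=> a b i j /=; apply: regular_cst.
  by apply: zariski_openI; apply: zariski_openT.
- by move=> a x _; rewrite /= mxE.
- by move=> a b c x _ _ _; rewrite /= mxE mul1mx.
Qed.

(** * The monad built from an enumeration of the monomials *)

Section MonomialMonad.
Variables (mu k : nat) (phi : nat -> mchart).
(** Only the values of the monomials are compared, since charts are bare dependent functions while
    the enumeration will run over finite functions. *)
Hypothesis phi_surj : forall a, exists2 j,
  (j < mu.+1 + mu.+1)%N & chart_val (phi j) =1 chart_val a.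

Local Notation mid := ((mu + k).+1 + (mu + k).+1)%N.
Local Notation M0 := (line_sum k.+1 (mprojO K e (fun=> -1))).
Local Notation M1 := (line_sum mid (trivial_line K X)).
Local Notation M2 := (line_sum k.+1 (mprojO K e (fun=> 1))).

(** The offsets [0] and [mu.+1] give the two polynomials [p] and [q] at the point [x]. *)
Definition half_form (h : nat) x : {poly K} :=
  \poly_(j < mu.+1) chart_val (phi (h + j)) x.

Lemma half_form_neq0 x : (half_form 0 x != 0) || (half_form mu.+1 x != 0).
Proof.
(* Charts cover the space, so some monomial is nonzero at [x]; its index lies in one of the two
   halves. *)
have [_ /(_ x)[a /chart_valP a0] _ _ _] := mprojO_is_bundle 1 1.
have [j ltj phij] := phi_surj a; rewrite -phij in a0.
have [ltj'|lej] := ltnP j mu.+1; apply/orP; [left|right].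
  by apply: contraNneq a0 => /polyP/(_ j); rewrite coef_poly ltj' coef0 => ->.
apply: contraNneq a0 => /polyP/(_ (j - mu.+1)%N).
by rewrite coef_poly ltn_subLR // ltj coef0 subnKC // => ->.
Qed.

(** Each entry is a single coefficient of the half form, hence one monomial or zero, and which one
    does not depend on [x]. *)
Lemma multilinear_form_toeplitz h i j :
  multilinear_form (fun x => toeplitz mu k (half_form h x) i j).
Proof.
rewrite (_ : (fun x => _) = fun x => if (i < j)%N then 0 else
    if (i - j < mu.+1)%N then chart_val (phi (h + (i - j))) x else 0).
  case: (i < j)%N; first exact: multilinear_form0.
  by case: (i - j < mu.+1)%N; [apply: multilinear_form_chart|apply: multilinear_form0].
by apply/funext => x; rewrite mxE coefXnM coef_poly.
Qed.

(** A coordinate [c] of O(-1, ..., -1) in the chart [a] stands for [c / chart_val a], while a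
    section [s] of O(1, ..., 1) has the coordinate [s / chart_val b]; hence the same inverse factor
    here and in [mor_out]. *)
Definition mor_in (a : mchart) (_ : unit) x :=
  (chart_val a x)^-1 *: monad_in mu k (half_form 0 x) (half_form mu.+1 x).

Definition mor_out (_ : unit) (b : mchart) x :=
  (chart_val b x)^-1 *: monad_out mu k (half_form 0 x) (half_form mu.+1 x).

Lemma mor_in_regular (a : chart M0) (b : chart M1) :
  regular_mx (dom a `&` dom b) (mor_in a b).
Proof.
move=> i j; pose F x := monad_in mu k (half_form 0 x) (half_form mu.+1 x) i j.
rewrite (_ : (fun x => _) = fun x => (chart_val a x)^-1 * F x); last first.
  by apply/funext => x; rewrite mxE.
apply: regular_multilinear_form.
- exact: zariski_openI (zariski_open_chart a) (zariski_openT).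
- by move=> x [].
rewrite /F /monad_in; case: (split_ordP i) => i' ->.
  rewrite (_ : (fun x => _) = fun x =>
      toeplitz mu k (half_form mu.+1 x) (rev_ord i') (rev_ord j)).
    exact: multilinear_form_toeplitz.
  by apply/funext => x; rewrite col_mxEu mxE.
rewrite (_ : (fun x => _) = fun x =>
    - toeplitz mu k (half_form 0 x) (rev_ord i') (rev_ord j)).
  exact/multilinear_formN/multilinear_form_toeplitz.
by apply/funext => x; rewrite col_mxEd !mxE.
Qed.

Lemma mor_out_regular (a : chart M1) (b : chart M2) :
  regular_mx (dom a `&` dom b) (mor_out a b).
Proof.
move=> i j; pose F x := monad_out mu k (half_form 0 x) (half_form mu.+1 x) i j.
rewrite (_ : (fun x => _) = fun x => (chart_val b x)^-1 * F x); last first.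
  by apply/funext => x; rewrite mxE.
apply: regular_multilinear_form.
- exact: zariski_openI zariski_openT (zariski_open_chart b).
- by move=> x [].
rewrite /F /monad_out; case: (split_ordP j) => j' ->.
  rewrite (_ : (fun x => _) = fun x => toeplitz mu k (half_form 0 x) j' i).
    exact: multilinear_form_toeplitz.
  by apply/funext => x; rewrite mxE col_mxEu.
rewrite (_ : (fun x => _) = fun x => toeplitz mu k (half_form mu.+1 x) j' i).
  exact: multilinear_form_toeplitz.
by apply/funext => x; rewrite mxE col_mxEd.
Qed.

Lemma mor_in_compat (a a' : chart M0) (b b' : chart M1) x :
  dom a x -> dom a' x -> dom b x -> dom b' x ->
  mor_in a' b' x *m tr a a' x = tr b b' x *m mor_in a b x.
Proof.
move=> _ /chart_valP a'0 _ _; rewrite tr_mprojO /= mxE mul1mx exprN1 invf_div.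
by rewrite mul_mx_scalar /mor_in scalerA mulrAC divff // mul1r.
Qed.

Lemma mor_out_compat (a a' : chart M1) (b b' : chart M2) x :
  dom a x -> dom a' x -> dom b x -> dom b' x ->
  mor_out a' b' x *m tr a a' x = tr b b' x *m mor_out a b x.
Proof.
move=> _ _ /chart_valP b0 _; rewrite tr_mprojO /= mxE mulmx1 expr1z.
by rewrite mul_scalar_mx /mor_out scalerA mulrAC divff // mul1r.
Qed.

Lemma monomial_monad :
  exists (A : bundle_hom M0 M1) (B : bundle_hom M1 M2), is_monad A B.
Proof.
exists (BundleHom mor_in_regular mor_in_compat).
exists (BundleHom mor_out_regular mor_out_compat).
have sz h x : (size (half_form h x) <= mu.+1)%N by apply: size_poly.
split.
- split; first exact: mprojO_is_bundle.
  by split; [apply: trivial_is_bundle|apply: mprojO_is_bundle].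
- move=> a b c x _ _ _; rewrite /= /mor_in /mor_out.
  by rewrite -scalemxAl -scalemxAr monad_out_in !scaler0.
- move=> a b x /chart_valP a0 _ u v /=; rewrite /mor_in -!scalemxAl.
  move/(scalerI (invr_neq0 a0)).
  exact: (monad_in_inj (sz _ _) (sz _ _) (half_form_neq0 x)).
move=> b c x _ /chart_valP c0 w /=.
have [v Bv] := monad_out_surj (sz _ x) (sz _ x) (half_form_neq0 x) w.
(* The scalar cancels the inverse factor in [mor_out]. *)
exists (chart_val c x *: v).
by rewrite /mor_out -scalemxAl -scalemxAr scalerA mulVf // scale1r.
Qed.

End MonomialMonad.

(** * Counting the monomials *)

Lemma toeplitz_monad (mu k : nat) :
  (\prod_i (e i).+1 = mu.+1 + mu.+1)%N -> (0 < k)%N ->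
  exists (A : bundle_hom (line_sum k (mprojO K e (fun=> -1)))
                (line_sum (2 * mu + 2 * k) (trivial_line K X)))
         (B : bundle_hom (line_sum (2 * mu + 2 * k) (trivial_line K X))
                (line_sum k (mprojO K e (fun=> 1)))),
    is_monad A B.
Proof.
move=> card_e; case: k => // k _; rewrite -size_monad_mid.
(* A monomial of multidegree (1, ..., 1) picks one coordinate on each factor. There are
   [mu.+1 + mu.+1] such choices, so the default of [nth] is never reached by the half forms. *)
pose F := {dffun forall i, 'I_(e i).+1}.
pose phi j : mchart := nth ([ffun i => ord0] : F) (enum F) j.
apply: (@monomial_monad mu k phi) => a.
exists (index ([ffun i => a i] : F) (enum F)); last first.
  move=> x; rewrite /phi nth_index ?mem_enum //.
  by apply: eq_bigr => i _; rewrite ffunE.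
suff <- : size (enum F) = (mu.+1 + mu.+1)%N by rewrite index_mem mem_enum.
rewrite -cardE card_dep_ffun foldrE big_map -card_e -big_enum /=.
by apply: eq_bigr => i _; rewrite card_ord.
Qed.

End Multiprojective.

(** The product is 2^l 4^m 6^n = 2^(l + 2m + n) 3^n, which is twice [mu.+1]. *)
Lemma prod_factor_dim (l m n : nat) : (0 < l)%N ->
  let mu := (2 ^ (l + 2 * m + n - 1) * 3 ^ n - 1)%N in
  (\prod_i (@factor_dim l m n i).+1 = mu.+1 + mu.+1)%N.
Proof.
move=> l0 mu; rewrite !big_sumType /= !prod_nat_const !card_ord.
have -> : mu.+1 = (2 ^ (l + 2 * m + n - 1) * 3 ^ n)%N.
  by rewrite /mu subn1 prednK // muln_gt0 !expn_gt0.
(* Positivity of [l] makes the truncated subtraction in the exponent exact, so the factor 2 restores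
   the full exponent. *)
rewrite addnn -mul2n mulnA -expnS subn1 prednK ?addn_gt0 ?l0 //.
by rewrite 2!expnD expnM -[RHS]mulnA -expnMn.
Qed.

Theorem theorem3p2 (R : realType) (l m n k : nat)
    (hl : (0 < l)%N) (hm : (0 < m)%N) (hn : (0 < n)%N) (hk : (0 < k)%N) :
  let X := mproj R[i] (@factor_dim l m n) in
  let mu := (2 ^ (l + 2 * m + n - 1) * 3 ^ n - 1)%N in
  exists (A : bundle_hom
                (line_sum k (mprojO R[i] (@factor_dim l m n) (fun=> -1)))
                (line_sum (2 * mu + 2 * k) (trivial_line R[i] X)))
         (B : bundle_hom
                (line_sum (2 * mu + 2 * k) (trivial_line R[i] X))
                (line_sum k (mprojO R[i] (@factor_dim l m n) (fun=> 1)))),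
    is_monad A B.
Proof. exact: (toeplitz_monad _ (prod_factor_dim m n hl) hk). Qed.
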